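(* Let $k$ be a field, $(I,\preceq)$ a directed set, $\{A_i,f_{ij}\}$ a direct system over $I$ of algebras over $k$ (resp. of groups), and $\{M_i,\varphi_{ij}\}$ a direct system over $I$ of vector spaces over $k$. Assume that $M_i$ is an $A_i$-module for each $i\in I$ and that for any $i,j\in I$ with $i\preceq j$ the homomorphism $\varphi_{ij}:M_i\to M_j$ is compatible with the homomorphism $f_{ij}:A_i\to A_j$, that is, $\varphi_{ij}(ux)=f_{ij}(u)\varphi_{ij}(x)$ for any $u\in A_i$ and $x\in M_i$. Then $M=\varinjlim M_i$ is naturally a module of $A=\varinjlim A_i$. Moreover, if $M_i$ is an irreducible $A_i$-module for each $i\in I$, then $M$ is an irreducible $A$-module.
   Context: All modules are over the field $k$; in the group case, a module of a group means a $k$-linear representation of that group.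
   Formalization: The irreducibility claim is proved under the added assumption that M is nonzero, since with zero maps φ_ij for i≠j (I the natural numbers, A_i=M_i=k) every M_i is irreducible but M=0; algebras are taken to be associative, unital and nonzero. *)

(* Defs.v *)
From mathcomp Require Import all_boot all_order all_algebra.
From mathcomp Require Import classical_sets.

Set Implicit Arguments.
Unset Strict Implicit.
Unset Printing Implicit Defensive.

Import Order.TTheory GRing.Theory.
Local Open Scope ring_scope.

Definition directed d (I : preorderType d) : Prop :=
  inhabited I /\ forall i j : I, exists l : I, (i <= l)%O /\ (j <= l)%O.

Section DirectSystems.
Context {d : Order.disp_t} {I : preorderType d}.

(* The underlying-set part of a direct system. The order relation is boolean,
   so a transition map does not depend on the proof of [i <= j]. *)
Definition direct_system (X : I -> Type)
    (f : forall i j : I, (i <= j)%O -> X i -> X j) : Prop :=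
  (forall i (le_ii : (i <= i)%O) x, f i i le_ii x = x) /\
  (forall i j l (le_ij : (i <= j)%O) (le_jl : (j <= l)%O) (le_il : (i <= l)%O)
     x, f i l le_il x = f j l le_jl (f i j le_ij x)).

Definition cocone (X : I -> Type)
    (f : forall i j : I, (i <= j)%O -> X i -> X j)
    (L : Type) (g : forall i, X i -> L) : Prop :=
  forall i j (le_ij : (i <= j)%O) x, g j (f i j le_ij x) = g i x.

(* [is_*_limit f g]: the object [L], with the canonical maps [g i : X i -> L],
   is the direct limit of the system [f] in the category of k-vector spaces,
   of (associative, unital) k-algebras, of groups. *)
Definition is_vect_limit (k : fieldType) (M : I -> lmodType k)
    (f : forall i j : I, (i <= j)%O -> {linear M i -> M j})
    (L : lmodType k) (g : forall i, {linear M i -> L}) : Prop :=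
  cocone (fun i j le_ij => f i j le_ij) (fun i => g i) /\
  forall (T : lmodType k) (h : forall i, {linear M i -> T}),
    cocone (fun i j le_ij => f i j le_ij) (fun i => h i) ->
    exists u : {linear L -> T}, (forall i x, u (g i x) = h i x) /\
      forall v : {linear L -> T}, (forall i x, v (g i x) = h i x) -> v =1 u.

(* [algType] excludes the zero ring as an object and as a test object [T]; the
   latter is harmless, as there is exactly one map to it from anything. *)
Definition is_alg_limit (k : fieldType) (A : I -> algType k)
    (f : forall i j : I, (i <= j)%O -> {lrmorphism A i -> A j})
    (L : algType k) (g : forall i, {lrmorphism A i -> L}) : Prop :=
  cocone (fun i j le_ij => f i j le_ij) (fun i => g i) /\
  forall (T : algType k) (h : forall i, {lrmorphism A i -> T}),
    cocone (fun i j le_ij => f i j le_ij) (fun i => h i) ->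
    exists u : {lrmorphism L -> T}, (forall i x, u (g i x) = h i x) /\
      forall v : {lrmorphism L -> T}, (forall i x, v (g i x) = h i x) -> v =1 u.

Definition is_group_limit (G : I -> groupType)
    (f : forall i j : I, (i <= j)%O -> {multiplicative G i -> G j})
    (L : groupType) (g : forall i, {multiplicative G i -> L}) : Prop :=
  cocone (fun i j le_ij => f i j le_ij) (fun i => g i) /\
  forall (T : groupType) (h : forall i, {multiplicative G i -> T}),
    cocone (fun i j le_ij => f i j le_ij) (fun i => h i) ->
    exists u : {multiplicative L -> T}, (forall i x, u (g i x) = h i x) /\
      forall v : {multiplicative L -> T},
        (forall i x, v (g i x) = h i x) -> v =1 u.

End DirectSystems.

(* An action [act u x] (written [u x] on paper) making the k-vector space [V] a
   module of a k-algebra; [act] is k-bilinear, so the two k-structures agree. *)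
Definition alg_module (k : fieldType) (A : algType k) (V : lmodType k)
    (act : A -> V -> V) : Prop :=
  [/\ forall u : A, linear (act u),
      forall x : V, linear (fun u : A => act u x),
      forall x : V, act 1 x = x &
      forall (u v : A) (x : V), act (u * v) x = act u (act v x)].

Definition group_module (k : fieldType) (G : groupType) (V : lmodType k)
    (act : G -> V -> V) : Prop :=
  [/\ forall u : G, linear (act u),
      forall x : V, act 1%g x = x &
      forall (u v : G) (x : V), act (u * v)%g x = act u (act v x)].

Section Irreducible.
Context {k : fieldType} {S : Type} {V : lmodType k}.

Definition submodule (act : S -> V -> V) (W : set V) : Prop :=
  [/\ W 0,
      forall (a : k) (x y : V), W x -> W y -> W (a *: x + y) &
      forall (u : S) (x : V), W x -> W (act u x)].

(* The zero module is not irreducible. A direct limit of irreducible modules can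
   be zero, e.g. when [f i j] = 0 for all i < j, so irreducibility of a limit
   needs the limit to be nonzero. *)
Definition irreducible (act : S -> V -> V) : Prop :=
  (exists x : V, x <> 0) /\
  forall W : set V, submodule act W -> W = [set 0]%classic \/ W = setT.

End Irreducible.

(* Main.v *)
(* Each [u : A i] acts on every [M j] with [i <= j]; as these [j] are cofinal,
   the universal property of [Mlim] turns these maps into one endomorphism of
   [Mlim]. So [A i] maps to End(Mlim) (resp. [G i] to Aut(Mlim)) compatibly with
   the transition maps, and the universal property of the limit of the [A i]
   yields the action and its uniqueness. Every element of [Mlim] comes from
   some [M j] with [j] arbitrarily large, since the elements which do form a
   subspace through which the cocone factors. Hence, for a nonzero submodule
   [W] of [Mlim], the preimages of [W] in [M j] are nonzero submodules for all
   large [j], so they are all of [M j], and [W] is everything. *)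

Require Import Defs.
From HB Require Import structures.
From mathcomp Require Import all_boot all_order all_algebra.
From mathcomp Require Import boolp classical_sets functions.

Set Implicit Arguments.
Unset Strict Implicit.
Unset Printing Implicit Defensive.

Import Order.TTheory GRing.Theory.
Local Open Scope ring_scope.

(** * Subspaces as vector spaces *)

Section Subspace.
Variables (k : fieldType) (V : lmodType k) (S : submodClosed V).

(** Packing a closed predicate into an [lmodType] allows a subspace to serve as test object in a
    universal property. *)
Record subspace := Subspace { subspace_val : V; _ : subspace_val \in S }.

HB.instance Definition _ := [isSub for subspace_val].
HB.instance Definition _ := [Choice of subspace by <:].
HB.instance Definition _ := [SubChoice_isSubLmodule of subspace by <:].

End Subspace.

(** * The endomorphism algebra of a nonzero vector space *)

Section Endomorphisms.
Variables (k : fieldType) (V : lmodType k).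

(** A boolean predicate, obtained classically, so that [endo] inherits its vector space structure
    from the function space [V -> V]. *)
Definition linear_pred : {pred V -> V} := fun f => `[< linear f >].

Lemma linear_predP (f : V -> V) : reflect (linear f) (f \in linear_pred).
Proof. exact: asboolP. Qed.

Fact linear_pred_submod_closed : submod_closed linear_pred.
Proof.
split=> [|a f g /linear_predP lf /linear_predP lg]; apply/linear_predP => b x y.
  by rewrite [RHS]addr0 scaler0.
change (a *: f (b *: x + y) + g (b *: x + y) =
        b *: (a *: f x + g x) + (a *: f y + g y)).
by rewrite lf lg !scalerDr !scalerA mulrC addrACA.
Qed.

HB.instance Definition _ :=
  GRing.isSubmodClosed.Build k (V -> V) linear_pred linear_pred_submod_closed.

(* The proof [nzV] is a phantom parameter: it makes the ring nontrivial, as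
   [algType] requires. *)
Record endo (nzV : exists x : V, x <> 0) :=
  Endo { endo_val :> V -> V; _ : endo_val \in linear_pred }.

Variable nzV : exists x : V, x <> 0.
HB.instance Definition _ := [isSub for @endo_val nzV].
HB.instance Definition _ := [Choice of endo nzV by <:].
HB.instance Definition _ := [SubChoice_isSubLmodule of endo nzV by <:].
Implicit Types f g : endo nzV.

Lemma endo_linear f : linear f.
Proof. by apply/linear_predP; case: f. Qed.

Lemma endoP f g : (forall x, f x = g x) -> f = g.
Proof. by move=> eq_fg; apply/val_inj/funext. Qed.

Fact endo_one_subproof : id \in linear_pred.
Proof. by apply/linear_predP. Qed.

Fact endo_mul_subproof f g : f \o g \in linear_pred.
Proof. by apply/linear_predP=> a x y /=; rewrite !endo_linear. Qed.

Definition endo_one : endo nzV := Endo nzV endo_one_subproof.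
Definition endo_mul f g : endo nzV := Endo nzV (endo_mul_subproof f g).

Fact endo_mulA : associative endo_mul.
Proof. by move=> f g h; apply: endoP. Qed.
Fact endo_mul1f : left_id endo_one endo_mul.
Proof. by move=> f; apply: endoP. Qed.
Fact endo_mulf1 : right_id endo_one endo_mul.
Proof. by move=> f; apply: endoP. Qed.
Fact endo_mulDl : left_distributive endo_mul +%R.
Proof. by move=> f g h; apply: endoP. Qed.
Fact endo_mulDr : right_distributive endo_mul +%R.
Proof.
move=> f g h; apply: endoP => x.
by have := endo_linear f 1 (g x) (h x); rewrite !scale1r.
Qed.
Fact endo_one_neq0 : endo_one != 0.
Proof.
case: nzV => x x_neq0; apply/eqP=> eq10; apply: x_neq0.
by have /(congr1 (@^~ x)) := congr1 val eq10.
Qed.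
HB.instance Definition _ := GRing.Zmodule_isNzRing.Build (endo nzV)
  endo_mulA endo_mul1f endo_mulf1 endo_mulDl endo_mulDr endo_one_neq0.

Fact endo_scaleAl (a : k) f g : a *: (f * g) = a *: f * g.
Proof. exact: endoP. Qed.
HB.instance Definition _ := GRing.Lmodule_isLalgebra.Build k (endo nzV)
  endo_scaleAl.
Fact endo_scaleAr (a : k) f g : a *: (f * g) = f * (a *: g).
Proof.
apply: endoP => x; have := endo_linear f a (g x) 0.
(* Linearity with coefficient -1 at the zero vector reads [f 0 = - f 0 + f 0]. *)
have -> : f 0 = 0.
  by have := endo_linear f (-1) 0 0; rewrite scaler0 scaleN1r addr0 addNr.
by rewrite !addr0.
Qed.
HB.instance Definition _ := GRing.Lalgebra_isAlgebra.Build k (endo nzV)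
  endo_scaleAr.

End Endomorphisms.

(** * The group of linear automorphisms of a vector space *)

Section Automorphisms.
Variables (k : fieldType) (V : lmodType k).

(** The inverse is stored as data, so that group inversion merely swaps the two maps; its linearity
    is derived from that of [autom_val]. *)
Record autom := Autom {
  autom_val :> V -> V;
  autom_inv_val : V -> V;
  autom_linear : linear autom_val;
  autom_valK : cancel autom_val autom_inv_val;
  autom_invK : cancel autom_inv_val autom_val }.

HB.instance Definition _ := gen_eqMixin autom.
HB.instance Definition _ := gen_choiceMixin autom.

(** The forward map determines its two-sided inverse, and the remaining fields are proofs, equal by
    proof irrelevance. *)
Lemma automP (f g : autom) : (forall x, f x = g x) -> f = g.
Proof.
case: f g => [f f' lf fK f'K] [g g' lg gK g'K] /= /funext eq_fg.
case: g / eq_fg lg gK g'K => lg gK g'K.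
have eq_fg' : f' = g' by apply: funext=> x; rewrite -{1}(g'K x) fK.
case: g' / eq_fg' gK g'K => gK g'K.
by congr Autom; apply: Prop_irrelevance.
Qed.

Fact autom_inv_linear (f : autom) : linear (autom_inv_val f).
Proof.
move=> a x y; apply: (can_inj (autom_valK f)).
by rewrite autom_linear !autom_invK.
Qed.

Fact autom_mul_linear (f g : autom) : linear (f \o g).
Proof. by move=> a x y /=; rewrite !autom_linear. Qed.

Definition autom_one : autom :=
  @Autom id id (fun _ _ _ => erefl) (fun _ => erefl) (fun _ => erefl).
Definition autom_inv (f : autom) : autom :=
  Autom (autom_inv_linear f) (autom_invK f) (autom_valK f).
Definition autom_mul (f g : autom) : autom :=
  Autom (autom_mul_linear f g) (can_comp (autom_valK f) (autom_valK g))
    (can_comp (autom_invK g) (autom_invK f)).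

Fact autom_mulA : associative autom_mul.
Proof. by move=> f g h; apply: automP. Qed.
Fact autom_mul1f : left_id autom_one autom_mul.
Proof. by move=> f; apply: automP. Qed.
Fact autom_mulf1 : right_id autom_one autom_mul.
Proof. by move=> f; apply: automP. Qed.
Fact autom_mulVf : left_inverse autom_one autom_inv autom_mul.
Proof. by move=> f; apply: automP => x; apply: autom_valK. Qed.
Fact autom_mulfV : right_inverse autom_one autom_inv autom_mul.
Proof. by move=> f; apply: automP => x; apply: autom_invK. Qed.

HB.instance Definition _ := isGroup.Build autom
  autom_mulA autom_mul1f autom_mulf1 autom_mulVf autom_mulfV.

End Automorphisms.

(** * Module structures as morphisms to endomorphisms or automorphisms *)

Section ModulesAsMorphisms.
Variables (k : fieldType) (V : lmodType k).

(** This turns an action into a morphism, the form to which the universal property of a limit of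
    algebras applies; [endo_alg_module] goes back. *)
Lemma alg_module_endo (nzV : exists x : V, x <> 0) (A : algType k)
    (act : A -> V -> V) : alg_module act ->
  exists v : {lrmorphism A -> endo nzV}, forall a x, v a x = act a x.
Proof.
move=> [act_lin act_linl act1 actM].
have act_mem a : act a \in @linear_pred k V by apply/linear_predP/act_lin.
pose v a : endo nzV := Endo nzV (act_mem a).
have v_linear : linear v.
  by move=> c a b; apply: endoP => x; apply: act_linl.
have v_monoid : monoid_morphism v.
  by split=> [|a b]; apply: endoP => x; [apply: act1 | apply: actM].
pose vL : {lrmorphism A -> endo nzV} := HB.pack v
  (GRing.isLinear.Build k A (endo nzV) _ v v_linear)
  (GRing.isMonoidMorphism.Build A (endo nzV) v v_monoid).
by exists vL.
Qed.

Lemma endo_alg_module (nzV : exists x : V, x <> 0) (A : algType k)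
  (v : {lrmorphism A -> endo nzV}) : alg_module (fun a x => v a x).
Proof.
split=> [a|x c a b|x|a b x]; first exact: endo_linear.
- by rewrite linearP.
- by rewrite rmorph1.
- by rewrite rmorphM.
Qed.

(** Each [act a] is invertible because [act a^-1] undoes it on both sides. *)
Lemma group_module_autom (G : groupType) (act : G -> V -> V) :
  group_module act ->
  exists v : {multiplicative G -> @autom k V}, forall a x, v a x = act a x.
Proof.
move=> [act_lin act1 actM].
have actK a : cancel (act a) (act a^-1%g).
  by move=> x; rewrite -actM mulVg act1.
have actVK a : cancel (act a^-1%g) (act a).
  by move=> x; rewrite -actM mulgV act1.
pose v a := Autom (act_lin a) (actK a) (actVK a).
have v_mul : {morph v : a b / (a * b)%g}.
  by move=> a b; apply: automP => x; apply: actM.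
pose vM : {multiplicative G -> @autom k V} := HB.pack v
  (isMultiplicative.Build G (@autom k V) v v_mul).
by exists vM.
Qed.

Lemma autom_group_module (G : groupType)
  (v : {multiplicative G -> @autom k V}) : group_module (fun a x => v a x).
Proof.
split=> [a|x|a b x]; first exact: autom_linear.
(* A multiplicative map between groups preserves the unit by cancellation in [v 1 * v 1 = v 1]. *)
- suff -> : v 1%g = 1%g by [].
  by apply: (mulgI (v 1%g)); rewrite -gmulfM !mulg1.
- by rewrite gmulfM.
Qed.

End ModulesAsMorphisms.

(** * Elements of a direct limit of vector spaces *)

Section VectorSpaceLimit.
Variables (k : fieldType) (d : Order.disp_t) (I : preorderType d).
Hypothesis I_directed : directed I.
Variable M : I -> lmodType k.
Variable phi : forall i j : I, (i <= j)%O -> {linear M i -> M j}.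
Variables (L : lmodType k) (phi_lim : forall i : I, {linear M i -> L}).
Hypothesis L_limit : is_vect_limit phi phi_lim.

(* The cocone factors through [S], and the induced map [L -> S -> L] is the
   identity by uniqueness. *)
Lemma vect_limit_sub (S : submodClosed L) :
  (forall i x, phi_lim i x \in S) -> forall a, a \in S.
Proof.
move=> limS; have [phi_lim_cocone L_univ] := L_limit.
pose h i x : subspace S := Subspace (limS i x).
have h_linear i : linear (h i).
  by move=> a x y; apply: val_inj; rewrite /= linearP.
pose hL i : {linear M i -> subspace S} :=
  HB.pack (h i) (GRing.isLinear.Build k (M i) (subspace S) _ (h i) (h_linear i)).
have h_cocone : cocone (fun i j le_ij => phi le_ij) (fun i => hL i).
  by move=> i j le_ij x; apply: val_inj; rewrite /= phi_lim_cocone.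
have [u [u_lim _]] := L_univ _ hL h_cocone.
have [v [_ v_uniq]] := L_univ _ phi_lim phi_lim_cocone.
move=> a; suff <- : val (u a) = a by apply: valP.
have uE : \val \o u =1 v by apply: v_uniq => i x /=; rewrite u_lim.
have idE : idfun =1 v by apply: v_uniq.
by rewrite [LHS]uE -idE.
Qed.

(** The elements represented above [i] form a subspace, since two representatives can be added at a
    common upper bound. It contains every image of [phi_lim], since any index can be raised above
    [i]. *)
Lemma vect_limit_surj (i : I) (a : L) : exists j (y : M j),
  (i <= j)%O /\ phi_lim j y = a.
Proof.
have [phi_lim_cocone _] := L_limit; have [_ I_dir] := I_directed.
pose P : {pred L} :=
  fun a => `[< exists j (y : M j), (i <= j)%O /\ phi_lim j y = a >].
have P_closed : submod_closed P.
  split; first by apply/asboolP; exists i, 0; rewrite linear0.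
  move=> c _ _ /asboolP[j [x [le_ij <-]]] /asboolP[l [y [_ <-]]].
  have [m [le_jm le_lm]] := I_dir j l; apply/asboolP.
  exists m, (c *: phi le_jm x + phi le_lm y).
  by rewrite (le_trans le_ij le_jm) linearP !phi_lim_cocone.
pose S : submodClosed L := HB.pack P (GRing.isSubmodClosed.Build k L P P_closed).
apply/asboolP; change (a \in S); apply: vect_limit_sub => j x.
have [l [le_il le_jl]] := I_dir i j.
by apply/asboolP; exists l, (phi le_jl x); rewrite phi_lim_cocone.
Qed.

(** This reduces identities between maps on the limit to computations at stages above [i], where
    elements of [S i] already act. *)
Lemma vect_limit_map_eq (i : I) (T : Type) (u v : L -> T) :
    (forall j, (i <= j)%O -> forall y, u (phi_lim j y) = v (phi_lim j y)) ->
  u =1 v.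
Proof.
by move=> eq_uv a; have [j [y [le_ij <-]]] := vect_limit_surj i a; apply: eq_uv.
Qed.

(** * The action of a single stage on the limit *)

Section Action.
Hypothesis phi_system : direct_system (fun i j le_ij => phi le_ij).
Variable S : I -> Type.
Variable f : forall i j : I, (i <= j)%O -> S i -> S j.
Hypothesis f_system : direct_system f.
Variable act : forall i : I, S i -> M i -> M i.
Hypothesis act_linear : forall i u, linear (@act i u).
Hypothesis act_compatible :
  forall i j (le_ij : (i <= j)%O) (u : S i) (x : M i),
    phi le_ij (act u x) = act (f le_ij u) (phi le_ij x).

Lemma vect_limit_act (i : I) (u : S i) : exists t : {linear L -> L},
  forall j (le_ij : (i <= j)%O) (y : M j),
    t (phi_lim j y) = phi_lim j (act (f le_ij u) y).
Proof.
have [phi_lim_cocone L_univ] := L_limit; have [_ I_dir] := I_directed.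
have [_ phi_comp] := phi_system; have [_ f_comp] := f_system.
(* A stage [j] need not lie above [i], so [h j] moves both [u] and [x] to a chosen upper bound [l j]
   and lets [u] act there. *)
have /choice[l l_ub] : forall j, exists l, (i <= l)%O /\ (j <= l)%O.
  by move=> j; apply: I_dir.
pose h j x := phi_lim (l j) (act (f (l_ub j).1 u) (phi (l_ub j).2 x)).
(* The choice of upper bound is immaterial: by compatibility, the values at [l j] and at [m] agree
   once pushed to some [n] above both. *)
have hE j m (le_im : (i <= m)%O) (le_jm : (j <= m)%O) x :
    h j x = phi_lim m (act (f le_im u) (phi le_jm x)).
  have [n [le_ln le_mn]] := I_dir (l j) m.
  rewrite /h -(phi_lim_cocone _ _ le_ln) -(phi_lim_cocone _ _ le_mn).
  rewrite !act_compatible.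
  have le_in := le_trans le_im le_mn; have le_jn := le_trans le_jm le_mn.
  by rewrite -!(phi_comp _ _ _ _ _ le_jn) -!(f_comp _ _ _ _ _ le_in).
have h_linear j : linear (h j).
  by move=> a x y; rewrite /h linearP act_linear linearP.
pose hL j : {linear M j -> L} :=
  HB.pack (h j) (GRing.isLinear.Build k (M j) L _ (h j) (h_linear j)).
have h_cocone : cocone (fun i j le_ij => phi le_ij) (fun j => hL j).
  move=> j m le_jm x /=.
  have [n [le_in le_mn]] := I_dir i m.
  rewrite (hE _ _ le_in le_mn) (hE _ _ le_in (le_trans le_jm le_mn)).
  by rewrite (phi_comp _ _ _ le_jm le_mn).
have [t [t_lim _]] := L_univ _ hL h_cocone.
(* When [j] is above [i], it can itself be taken as upper bound, and [phi] from [j] to [j] is the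
   identity. *)
exists t => j le_ij y; rewrite t_lim /= (hE j j le_ij (lexx j)).
by have [-> _] := phi_system.
Qed.

Definition lim_act (i : I) (u : S i) : {linear L -> L} :=
  projT1 (cid (vect_limit_act u)).

Lemma lim_actE (i j : I) (le_ij : (i <= j)%O) (u : S i) (y : M j) :
  lim_act u (phi_lim j y) = phi_lim j (act (f le_ij u) y).
Proof. exact: (projT2 (cid (vect_limit_act u))). Qed.

(** At any stage above [j], both sides act through the same image of [u], by functoriality of
    [f]. *)
Lemma lim_act_cocone (i j : I) (le_ij : (i <= j)%O) (u : S i) :
  lim_act (f le_ij u) =1 lim_act u.
Proof.
apply: (@vect_limit_map_eq j) => l le_jl y.
have [_ f_comp] := f_system.
have le_il := le_trans le_ij le_jl.
by rewrite (lim_actE le_jl) (lim_actE le_il) (f_comp _ _ _ le_ij le_jl le_il).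
Qed.

(** This is the source of uniqueness: an action compatible with [phi_lim] is forced on elements
    coming from a stage. [SL] is a bare type, so that algebras and groups are covered together. *)
Lemma eq_lim_act (SL : Type) (f_lim : forall i, S i -> SL)
    (act_lim : SL -> L -> L) :
    cocone f f_lim ->
    (forall i (u : S i) (x : M i),
       phi_lim i (act u x) = act_lim (f_lim i u) (phi_lim i x)) ->
  forall i (u : S i), act_lim (f_lim i u) =1 lim_act u.
Proof.
move=> f_lim_cocone act_limE i u; apply: (@vect_limit_map_eq i) => j le_ij y.
by rewrite (lim_actE le_ij) -(f_lim_cocone _ _ le_ij) act_limE.
Qed.

Lemma irreducible_vect_limit (SL : Type) (f_lim : forall i, S i -> SL)
    (act_lim : SL -> L -> L) :
    (forall i (u : S i) (x : M i),
       phi_lim i (act u x) = act_lim (f_lim i u) (phi_lim i x)) ->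
    (forall i, irreducible (@act i)) ->
  (exists x : L, x <> 0) -> irreducible act_lim.
Proof.
have [phi_lim_cocone _] := L_limit; have [[i0] I_dir] := I_directed.
move=> act_limE act_irr nzL; split=> // W [W0 W_lin W_act].
have [W_triv|] := pselect (forall x, W x -> x = 0).
  by left; apply/seteqP; split=> x; [apply: W_triv | move->].
move=> /existsNP[x /not_implyP[Wx x_neq0]]; right.
have [i [xi [_ xiE]]] := vect_limit_surj i0 x.
(* Lifting [y] above [i] places representatives of both [x] and [y] in one irreducible module
   [M j]. *)
apply/seteqP; split=> // y _; have [j [yj [le_ij <-]]] := vect_limit_surj i y.
have [_ /(_ (phi_lim j @^-1` W)%classic)[]] := act_irr j.
- split=> [|a z z' Wz Wz'|u z Wz] /=; first by rewrite linear0.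
    by rewrite linearP; apply: W_lin.
  by rewrite act_limE; apply: W_act.
(* The preimage of [W] cannot be zero: it contains [phi le_ij xi], whose image in the limit is the
   nonzero [x]. *)
- move=> /seteqP[/(_ (phi le_ij xi)) sub0 _].
  case: x_neq0; rewrite -xiE -(phi_lim_cocone _ _ le_ij) sub0 ?linear0 //=.
  by rewrite phi_lim_cocone xiE.
- by move=> WT; have : setT yj by []; rewrite -WT.
Qed.

End Action.

End VectorSpaceLimit.

(** * Module structures over the limit algebra and the limit group *)

Section ModuleLimits.
Variables (k : fieldType) (d : Order.disp_t) (I : preorderType d).
Hypothesis I_directed : directed I.
Variable M : I -> lmodType k.
Variable phi : forall i j : I, (i <= j)%O -> {linear M i -> M j}.
Hypothesis phi_system : direct_system (fun i j le_ij => phi le_ij).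
Variables (L : lmodType k) (phi_lim : forall i : I, {linear M i -> L}).
Hypothesis L_limit : is_vect_limit phi phi_lim.

Lemma alg_module_limit (A : I -> algType k)
    (f : forall i j : I, (i <= j)%O -> {lrmorphism A i -> A j})
    (f_system : direct_system (fun i j le_ij => f i j le_ij))
    (AL : algType k) (f_lim : forall i : I, {lrmorphism A i -> AL})
    (AL_limit : is_alg_limit f f_lim)
    (act : forall i : I, A i -> M i -> M i)
    (act_module : forall i : I, alg_module (act i))
    (compatible : forall (i j : I) (le_ij : (i <= j)%O) (u : A i) (x : M i),
       phi le_ij (act i u x) = act j (f i j le_ij u) (phi le_ij x)) :
  exists act_lim : AL -> L -> L,
    [/\ alg_module act_lim,
        forall (i : I) (u : A i) (x : M i),
          phi_lim i (act i u x) = act_lim (f_lim i u) (phi_lim i x) &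
        forall act' : AL -> L -> L,
          alg_module act' ->
          (forall (i : I) (u : A i) (x : M i),
             phi_lim i (act i u x) = act' (f_lim i u) (phi_lim i x)) ->
          forall (u : AL) (x : L), act' u x = act_lim u x].
Proof.
(* The zero space is treated apart because [endo] requires a nonzero vector; there all equations
   hold trivially. *)
have [nzL|zL] := pselect (exists x : L, x <> 0); last first.
  have {}zL (x y : L) : x = y.
    suff L0 (z : L) : z = 0 by rewrite (L0 x) (L0 y).
    by apply: contrapT => z_neq0; apply: zL; exists z.
  by exists (fun _ _ => 0); split=> [|i u x|*];
    first split=> [u c x y|x c u v|x|u v x]; apply: zL.
have [f_lim_cocone AL_univ] := AL_limit.
have [f_id _] := f_system.
have act_linear i u : linear (act i u) by have [+ _ _ _] := act_module i; apply.
pose lact i : A i -> {linear L -> L} :=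
  lim_act I_directed L_limit phi_system f_system act_linear compatible (i := i).
have lactE i j (le_ij : (i <= j)%O) (u : A i) (y : M j) :
  lact i u (phi_lim j y) = phi_lim j (act j (f i j le_ij u) y) by exact: lim_actE.
have lact_ext i (t t' : L -> L) :
    (forall j, (i <= j)%O -> forall y, t (phi_lim j y) = t' (phi_lim j y)) ->
  t =1 t' by exact: (vect_limit_map_eq I_directed L_limit).
(* Each module law is checked at stages [j] above [i], where it follows from the law for [A j] and
   the morphism property of [f i j]. *)
have lact_module i : alg_module (fun u : A i => lact i u).
  split=> [u|x c u v|x|u v x]; first exact: linearP.
  - apply: (lact_ext i (lact i (c *: u + v))
             (fun x => c *: lact i u x + lact i v x)) => j le_ij y.
    have [_ act_linl _ _] := act_module j.
    by rewrite !(lactE _ _ le_ij) linearP [act j _ y]act_linl linearP.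
  - apply: (lact_ext i (lact i 1) id) => j le_ij y.
    by rewrite (lactE _ _ le_ij) rmorph1; have [_ _ -> _] := act_module j.
  - apply: (lact_ext i (lact i (u * v)) (lact i u \o lact i v)) => j le_ij y.
    rewrite /= !(lactE _ _ le_ij) rmorphM.
    by have [_ _ _ ->] := act_module j.
have /all_tag[h hE] i : {h : {lrmorphism A i -> endo nzL} &
    forall u x, h u x = lact i u x}.
  by apply: cid; apply: alg_module_endo.
have h_cocone : cocone (fun i j le_ij => f i j le_ij) (fun i => h i).
  move=> i j le_ij u; apply: endoP => x; rewrite !hE; exact: lim_act_cocone.
have [v [v_lim v_uniq]] := AL_univ _ h h_cocone.
exists (fun a x => v a x); split.
- exact: endo_alg_module.
(* The case [j = i] of [lactE], with [f i i] the identity. *)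
- by move=> i u x; rewrite v_lim hE (lactE _ _ (lexx i)) f_id.
move=> act' act'_module act'E a x.
(* A competing action gives a morphism [w] that agrees with [h i] on each [A i], hence equals [v] by
   the universal property. *)
have [w wE] := alg_module_endo nzL act'_module.
rewrite -wE (v_uniq w) // => i u; apply: endoP => y; rewrite wE hE.
exact: (eq_lim_act I_directed L_limit phi_system f_system act_linear compatible
          f_lim_cocone act'E).
Qed.

(** The argument for algebras carries over with [autom L] as test object; it is a group even for the
    zero space, so no case distinction arises. *)
Lemma group_module_limit (G : I -> groupType)
    (f : forall i j : I, (i <= j)%O -> {multiplicative G i -> G j})
    (f_system : direct_system (fun i j le_ij => f i j le_ij))
    (GL : groupType) (f_lim : forall i : I, {multiplicative G i -> GL})
    (GL_limit : is_group_limit f f_lim)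
    (act : forall i : I, G i -> M i -> M i)
    (act_module : forall i : I, group_module (act i))
    (compatible : forall (i j : I) (le_ij : (i <= j)%O) (u : G i) (x : M i),
       phi le_ij (act i u x) = act j (f i j le_ij u) (phi le_ij x)) :
  exists act_lim : GL -> L -> L,
    [/\ group_module act_lim,
        forall (i : I) (u : G i) (x : M i),
          phi_lim i (act i u x) = act_lim (f_lim i u) (phi_lim i x) &
        forall act' : GL -> L -> L,
          group_module act' ->
          (forall (i : I) (u : G i) (x : M i),
             phi_lim i (act i u x) = act' (f_lim i u) (phi_lim i x)) ->
          forall (u : GL) (x : L), act' u x = act_lim u x].
Proof.
have [f_lim_cocone GL_univ] := GL_limit.
have [f_id _] := f_system.
have act_linear i u : linear (act i u) by have [+ _ _] := act_module i; apply.
pose lact i : G i -> {linear L -> L} :=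
  lim_act I_directed L_limit phi_system f_system act_linear compatible (i := i).
have lactE i j (le_ij : (i <= j)%O) (u : G i) (y : M j) :
  lact i u (phi_lim j y) = phi_lim j (act j (f i j le_ij u) y) by exact: lim_actE.
have lact_ext i (t t' : L -> L) :
    (forall j, (i <= j)%O -> forall y, t (phi_lim j y) = t' (phi_lim j y)) ->
  t =1 t' by exact: (vect_limit_map_eq I_directed L_limit).
have lact_module i : group_module (fun u : G i => lact i u).
  split=> [u|x|u v x]; first exact: linearP.
  - apply: (lact_ext i (lact i 1%g) id) => j le_ij y.
    (* Again, preservation of the unit comes from cancellation. *)
    have f1 : f i j le_ij 1%g = 1%g.
      by apply: (mulgI (f i j le_ij 1%g)); rewrite -gmulfM !mulg1.
    by rewrite (lactE _ _ le_ij) f1; have [_ -> _] := act_module j.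
  - apply: (lact_ext i (lact i (u * v)%g) (lact i u \o lact i v)) => j le_ij y.
    rewrite /= !(lactE _ _ le_ij) gmulfM.
    by have [_ _ ->] := act_module j.
have /all_tag[h hE] i : {h : {multiplicative G i -> autom L} &
    forall u x, h u x = lact i u x}.
  by apply: cid; apply: group_module_autom.
have h_cocone : cocone (fun i j le_ij => f i j le_ij) (fun i => h i).
  move=> i j le_ij u; apply: automP => x; rewrite !hE; exact: lim_act_cocone.
have [v [v_lim v_uniq]] := GL_univ _ h h_cocone.
exists (fun a x => v a x); split.
- exact: autom_group_module.
- by move=> i u x; rewrite v_lim hE (lactE _ _ (lexx i)) f_id.
move=> act' act'_module act'E a x.
have [w wE] := group_module_autom act'_module.
rewrite -wE (v_uniq w) // => i u; apply: automP => y; rewrite wE hE.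
exact: (eq_lim_act I_directed L_limit phi_system f_system act_linear compatible
          f_lim_cocone act'E).
Qed.

End ModuleLimits.

Theorem lemma1p5 (k : fieldType) (d : Order.disp_t) (I : preorderType d)
    (I_directed : directed I)
    (M : I -> lmodType k)
    (phi : forall i j : I, (i <= j)%O -> {linear M i -> M j})
    (phi_system : direct_system (fun i j le_ij => phi i j le_ij))
    (Mlim : lmodType k) (phi_lim : forall i : I, {linear M i -> Mlim})
    (Mlim_limit : is_vect_limit phi phi_lim) :
  (* algebras *)
  (forall (A : I -> algType k)
     (f : forall i j : I, (i <= j)%O -> {lrmorphism A i -> A j})
     (f_system : direct_system (fun i j le_ij => f i j le_ij))
     (Alim : algType k) (f_lim : forall i : I, {lrmorphism A i -> Alim})
     (Alim_limit : is_alg_limit f f_lim)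
     (act : forall i : I, A i -> M i -> M i)
     (act_module : forall i : I, alg_module (act i))
     (compatible : forall (i j : I) (le_ij : (i <= j)%O) (u : A i) (x : M i),
        phi i j le_ij (act i u x) = act j (f i j le_ij u) (phi i j le_ij x)),
   exists act_lim : Alim -> Mlim -> Mlim,
     [/\ alg_module act_lim,
         forall (i : I) (u : A i) (x : M i),
           phi_lim i (act i u x) = act_lim (f_lim i u) (phi_lim i x),
         forall act' : Alim -> Mlim -> Mlim,
           alg_module act' ->
           (forall (i : I) (u : A i) (x : M i),
              phi_lim i (act i u x) = act' (f_lim i u) (phi_lim i x)) ->
           forall (u : Alim) (x : Mlim), act' u x = act_lim u x &
         (forall i : I, irreducible (act i)) ->
         (exists x : Mlim, x <> 0) -> irreducible act_lim])
  /\
  (* groups *)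
  (forall (G : I -> groupType)
     (f : forall i j : I, (i <= j)%O -> {multiplicative G i -> G j})
     (f_system : direct_system (fun i j le_ij => f i j le_ij))
     (Glim : groupType) (f_lim : forall i : I, {multiplicative G i -> Glim})
     (Glim_limit : is_group_limit f f_lim)
     (act : forall i : I, G i -> M i -> M i)
     (act_module : forall i : I, group_module (act i))
     (compatible : forall (i j : I) (le_ij : (i <= j)%O) (u : G i) (x : M i),
        phi i j le_ij (act i u x) = act j (f i j le_ij u) (phi i j le_ij x)),
   exists act_lim : Glim -> Mlim -> Mlim,
     [/\ group_module act_lim,
         forall (i : I) (u : G i) (x : M i),
           phi_lim i (act i u x) = act_lim (f_lim i u) (phi_lim i x),
         forall act' : Glim -> Mlim -> Mlim,
           group_module act' ->
           (forall (i : I) (u : G i) (x : M i),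
              phi_lim i (act i u x) = act' (f_lim i u) (phi_lim i x)) ->
           forall (u : Glim) (x : Mlim), act' u x = act_lim u x &
         (forall i : I, irreducible (act i)) ->
         (exists x : Mlim, x <> 0) -> irreducible act_lim]).
Proof.
split=> [A f f_system Alim f_lim Alim_limit act act_module compatible|
         G f f_system Glim f_lim Glim_limit act act_module compatible].
- have [act_lim [lim_module limE lim_uniq]] := alg_module_limit I_directed
    phi_system Mlim_limit f_system Alim_limit act_module compatible.
  exists act_lim; split=> // act_irr nzM.
  (* Irreducibility rests on the compatibility [limE] of [act_lim] with the stages, in the same way
     for algebras and groups. *)
  exact: (irreducible_vect_limit I_directed Mlim_limit limE).
have [act_lim [lim_module limE lim_uniq]] := group_module_limit I_directed
  phi_system Mlim_limit f_system Glim_limit act_module compatible.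
exists act_lim; split=> // act_irr nzM.
exact: (irreducible_vect_limit I_directed Mlim_limit limE).
Qed.
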